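(* Let $S_1$ and $S_2$ be two isometries on a Hilbert space such that $S_1S_1^*+S_2S_2^*=1$. Let $u$ and $w$ be two unitaries on the same Hilbert space such that $C^*(S_1,S_2,u)\subseteq C^*(S_1,S_2,w)$, and such that $u^2=w^2=1$, $uS_1=S_2u$ and $wS_1=S_2w$. Then $u=w$ or $u=-w$.
   Context: $C^*(X_1,\dots,X_n)$ denotes the C*-algebra of operators generated by $X_1,\dots,X_n$. *)

(* Defs.v *)
From HB Require Import structures.
From mathcomp Require Import all_boot all_order all_algebra.
From mathcomp Require Import complex.
From mathcomp Require Import boolp classical_sets functions reals.
From mathcomp Require Import topology normedtype.

Set Implicit Arguments.
Unset Strict Implicit.
Unset Printing Implicit Defensive.

Import Order.TTheory GRing.Theory Num.Theory.
Import numFieldNormedType.Exports.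

Local Open Scope classical_set_scope.
Local Open Scope ring_scope.

(* As for every [{dot _ for conjC}] form, the inner product is linear in its
   first argument and conjugate-linear in its second one. *)
HB.mixin Record NormedModule_hasInner (R : realType) H
    of NormedModule R[i] H := {
  inner : {dot H for @Num.conj R[i]} ;
  inner_normE : forall x : H, inner x x = `|x| ^+ 2
}.

#[short(type="hilbertType")]
HB.structure Definition Hilbert (R : realType) :=
  { H of CompleteNormedModule R[i] H & NormedModule_hasInner R H }.

Section Operators.
Context {R : realType} {H : hilbertType R}.
Implicit Types (T S : H -> H) (A X : set (H -> H)).

Definition bounded_operator : set (H -> H) :=
  [set T | linear T /\ exists M : R[i], forall x, `|T x| <= M * `|x| ].

Definition is_adjoint T S := forall x y : H, inner (T x) y = inner x (S y).

(* Every bounded operator has exactly one adjoint (Riesz); the default value 0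
   only matters for functions that are not bounded operators. *)
Definition adjoint T : H -> H := xget 0 [set S | is_adjoint T S].

(* Norms are elements of [R[i]] with zero imaginary part. *)
Definition opnorm T : R :=
  sup [set complex.Re `|T x| | x in [set x : H | `|x| <= 1]].

Definition isometric_operator T := bounded_operator T /\ forall x, `|T x| = `|x|.

Definition unitary_operator T :=
  [/\ bounded_operator T, adjoint T \o T = idfun & T \o adjoint T = idfun].

(* Membership of the identity is not required: C*-subalgebras may fail to be
   unital. *)
Record cstar_subalgebra A : Prop := CstarSubalgebra {
  cstar_bounded : A `<=` bounded_operator ;
  cstar0 : A 0 ;
  cstarD : forall T S, A T -> A S -> A (T + S) ;
  cstarZ : forall (a : R[i]) T, A T -> A (a *: T) ;
  cstarM : forall T S, A T -> A S -> A (T \o S) ;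
  cstar_adjoint : forall T, A T -> A (adjoint T) ;
  cstar_norm_closed : forall T, bounded_operator T ->
    (forall e : R, 0 < e -> exists2 S, A S & opnorm (T - S) < e) -> A T
}.

Definition cstar_generated X : set (H -> H) :=
  \bigcap_(A in [set A | cstar_subalgebra A /\ X `<=` A]) A.

Lemma adjointE T S : is_adjoint T S -> adjoint T = S.
Proof.
move=> TS; apply/funext => y; apply/eqP; rewrite -subr_eq0.
have TS' : is_adjoint T (adjoint T) by exact: (@xgetPex _ 0 _ (ex_intro _ S TS)).
rewrite -(dnorm_eq0 (inner : {dot H for Num.conj})) linearB/=.
by rewrite -TS -TS' subrr.
Qed.

End Operators.

(* Main.v *)
Require Import Defs.
From HB Require Import structures.
From mathcomp Require Import all_boot all_order all_algebra.
From mathcomp Require Import complex.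
From mathcomp Require Import boolp classical_sets functions reals.
From mathcomp Require Import topology normedtype.
From mathcomp Require Import ring.
Import Order.TTheory GRing.Theory Num.Theory numFieldNormedType.Exports.
Local Open Scope classical_set_scope.
Local Open Scope ring_scope.

Set Implicit Arguments.
Unset Strict Implicit.
Unset Printing Implicit Defensive.

(** Conjugation by [u] and conjugation by [w] both exchange [S1] and [S2], so
    [z = w u] commutes with [S1] and [S2].  The claim is that such a [z], lying
    in the C*-algebra generated by [S1], [S2] and [w], must be a scalar [a];
    then [u = a w], and comparing squares gives [a = 1] or [a = -1].

    The triviality of this relative commutant comes from a compression
    argument in the style of Cuntz.  Write [S_mu] for the product of the
    isometries along a word [mu] in two letters.  The relations
    [S_i^* S_j = delta_ij], [w S_i = S_(1-i) w] and [w w = 1] make the linear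
    span of the monomials [S_mu S_nu^* w^e] a *-algebra, so the C*-algebra in
    question is contained in its norm closure ([closure_cstar]).  Let
    [V = S1^m S2].  When [m] exceeds the lengths of [mu] and [nu], the
    compression [V^* S_mu S_nu^* w^e V] is the scalar 0 or 1
    ([compress_monomial]): the prefixes of the word 1...12 are powers of the
    letter 1 and the final 2 records how long they were, so only [mu = nu]
    survives when [e = 0]; when [e = 1], moving [w] through [V] leaves a word
    that starts with the wrong letter.  Hence every element of the span is
    compressed to a scalar by all long enough [V].

    An element [z] of the closure which commutes with the [S_i] satisfies
    [V^* z V = V^* V z = z]; as compression by [V] is contractive, [z] is a norm
    limit of scalars, hence a scalar ([closure_commutant]).

    On a nonzero space [S1] and [S2] have adjoints for the following reason:
    [w] turns an adjoint of one of them into an adjoint of the other, and if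
    both were missing, both terms of [S1 S1^* + S2 S2^* = 1] would vanish by the
    default value of [adjoint].  The same default value makes the norm closure
    stable under [adjoint]. *)

(** * Linear spans of operators *)

Section Span.
Context {K : nzRingType} {V : lmodType K}.
Implicit Types (X Y : set (V -> V)) (T P : V -> V).

(** The constructor adds one generator at a time: induction on a span then
    meets generators and already treated elements only. *)
Inductive op_span X : set (V -> V) :=
| op_span0 : op_span X 0
| op_spanP a T P : X T -> op_span X P -> op_span X (a *: T + P).

Lemma op_spanD X T P : op_span X T -> op_span X P -> op_span X (T + P).
Proof.
move=> XT XP; elim: XT => [|a S Q XS _ IH]; first by rewrite add0r.
by rewrite -addrA; apply: op_spanP.
Qed.

Lemma op_spanZ X a T : op_span X T -> op_span X (a *: T).
Proof.
elim=> [|b S Q XS _ IH]; first by rewrite scaler0; apply: op_span0.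
by rewrite scalerDr scalerA; apply: op_spanP.
Qed.

Lemma mem_op_span X T : X T -> op_span X T.
Proof.
move=> XT; rewrite -[T]addr0 -[T]scale1r.
by apply: op_spanP => //; apply: op_span0.
Qed.

Lemma op_span_compl X Y (T : {linear V -> V}) :
  (forall P, X P -> op_span Y (T \o P)) ->
  forall P, op_span X P -> op_span Y (T \o P).
Proof.
move=> XY P; elim=> [|a S Q XS _ IH].
  rewrite (_ : _ \o _ = 0); first exact: op_span0.
  by apply/funext => x /=; rewrite linear0.
rewrite (_ : _ \o _ = a *: (T \o S) + (T \o Q)).
  exact: op_spanD (op_spanZ _ (XY _ XS)) IH.
by apply/funext => x /=; rewrite linearP.
Qed.

Lemma op_span_compr X P :
  (forall T, X T -> op_span X (T \o P)) ->
  forall T, op_span X T -> op_span X (T \o P).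
Proof.
move=> XP T; elim=> [|a S Q XS _ IH]; first exact: op_span0.
by apply: (@op_spanD _ (a *: (S \o P))) => //; apply/op_spanZ/XP.
Qed.

End Span.

(** * The algebra of two Cuntz isometries and their flip *)

Section CuntzFlip.
Context {K : nzRingType} {V : lmodType K}.
Variables (S Sa : bool -> {linear V -> V}) (w : {linear V -> V}).
Hypothesis SaS : forall i j x, Sa i (S j x) = if i == j then x else 0.
Hypothesis wS : forall i x, w (S i x) = S (~~ i) (w x).
Hypothesis wSa : forall i x, w (Sa i x) = Sa (~~ i) (w x).
Hypothesis ww : forall x, w (w x) = x.
Implicit Types (mu nu : seq bool) (b e : bool) (x : V).

Definition word mu x : V := foldr (fun i y => S i y) x mu.

(** The letters act in the opposite order to those of [word]: this is the
    operator [S_nu^*] when [Sa] consists of the adjoints of [S]. *)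
Definition word_adj nu x : V := foldl (fun y i => Sa i y) x nu.

Definition monomial mu nu e x : V :=
  word mu (word_adj nu (if e then w x else x)).

Definition monomials : set (V -> V) :=
  [set T | exists mu nu e, T = monomial mu nu e].

Lemma word_adj0 nu : word_adj nu 0 = 0.
Proof. by elim: nu => //= i mu; rewrite linear0. Qed.

Lemma wordP a mu x y : word mu (a *: x + y) = a *: word mu x + word mu y.
Proof. by elim: mu => //= i mu ->; rewrite linearP. Qed.

Lemma word_adjP a nu x y :
  word_adj nu (a *: x + y) = a *: word_adj nu x + word_adj nu y.
Proof. by elim: nu x y => //= i nu IH x y; rewrite linearP IH. Qed.

Lemma w_word mu x : w (word mu x) = word (map negb mu) (w x).
Proof. by elim: mu => //= i mu IH; rewrite wS IH. Qed.

Lemma w_word_adj nu x : w (word_adj nu x) = word_adj (map negb nu) (w x).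
Proof. by elim: nu x => //= i nu IH x; rewrite IH wSa. Qed.

Lemma S_monomials i T : monomials T -> monomials (S i \o T).
Proof. by case=> [mu [nu [e ->]]]; exists (i :: mu), nu, e. Qed.

Lemma w_monomials T : monomials T -> monomials (w \o T).
Proof.
case=> [mu [nu [e ->]]]; exists (map negb mu), (map negb nu), (~~ e).
apply/funext => x; rewrite /monomial /= w_word w_word_adj.
by case: e => //=; rewrite ww.
Qed.

(** The only left multiplication which can leave the set of monomials:
    [S_i^* S_j = 0] for distinct letters. *)
Lemma Sa_monomials i T : monomials T -> op_span monomials (Sa i \o T).
Proof.
case=> [mu [nu [e ->]]]; case: mu => [|j mu].
  apply: mem_op_span; exists [::], (rcons nu i), e.
  by apply/funext => x; rewrite /monomial /= /word_adj foldl_rcons.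
case: (eqVneq i j) => [-> | ij].
  apply: mem_op_span; exists mu, nu, e.
  by apply/funext => x; rewrite /monomial /= SaS eqxx.
rewrite (_ : _ \o _ = 0); first exact: op_span0.
by apply/funext => x; rewrite /monomial /= SaS (negPf ij).
Qed.

Let B := op_span monomials.

Lemma span_id : B idfun.
Proof. by apply: mem_op_span; exists [::], [::], false. Qed.

Lemma span_S i T : B T -> B (S i \o T).
Proof. by apply: op_span_compl => P /(S_monomials i)/mem_op_span. Qed.

Lemma span_w T : B T -> B (w \o T).
Proof. by apply: op_span_compl => P /w_monomials/mem_op_span. Qed.

Lemma span_Sa i T : B T -> B (Sa i \o T).
Proof. by apply: op_span_compl => P; apply: Sa_monomials. Qed.

Lemma span_word mu T : B T -> B (word mu \o T).
Proof. by move=> BT; elim: mu => //= i mu; apply: span_S. Qed.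

Lemma span_word_adj nu T : B T -> B (word_adj nu \o T).
Proof. by elim: nu T => //= i nu IH T /(span_Sa i); apply: IH. Qed.

Lemma span_w_if e T : B T -> B ((fun x => if e then w x else x) \o T).
Proof. by case: e => //; apply: span_w. Qed.

(** A product of monomials is rewritten from the right, one letter of the left
    factor at a time, so that stability under left multiplication by the
    generators suffices. *)
Lemma span_comp T P : B T -> B P -> B (T \o P).
Proof.
move=> + BP; apply: op_span_compr => _ [mu [nu [e ->]]].
exact: span_word (span_word_adj _ (span_w_if e BP)).
Qed.

(** The last letter makes the word aperiodic: removing different numbers of
    leading [b]'s from it leaves words none of which is a prefix of another. *)
Definition spike b m := rcons (nseq m b) (~~ b).

Lemma spike_isometry b m x : word_adj (spike b m) (word (spike b m) x) = x.
Proof.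
rewrite /spike /word_adj /word -!cats1 foldl_cat foldr_cat /=.
by elim: m => [|m IH] /=; rewrite SaS eqxx.
Qed.

Lemma spike_orthogonal m n x :
  word_adj (spike false m) (word (spike false n) x) = if m == n then x else 0.
Proof.
elim: m n => [|m IH] [|n] /=; rewrite !SaS //=.
- by rewrite word_adj0.
- exact: IH.
Qed.

(** The lengths are positive because [spike false 0] and [spike true n.+1] both
    start with the letter [true]. *)
Lemma spike_flip_orthogonal m n x :
  word_adj (spike false m.+1) (word (spike true n.+1) x) = 0.
Proof. by rewrite /= SaS word_adj0. Qed.

Lemma word_adj_spike nu b m x : (size nu <= m)%N ->
  word_adj nu (word (spike b m) x) =
    if all (pred1 b) nu then word (spike b (m - size nu)) x else 0.
Proof.
elim: nu m => [|i nu IH] [|m] //=; rewrite ltnS => le_m.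
by rewrite SaS; case: eqP => _ /=; [rewrite IH | rewrite word_adj0].
Qed.

Lemma spike_adj_word mu b m x : (size mu <= m)%N ->
  word_adj (spike b m) (word mu x) =
    if all (pred1 b) mu then word_adj (spike b (m - size mu)) x else 0.
Proof.
elim: mu m => [|i mu IH] [|m] //=; rewrite ltnS => le_m.
by rewrite SaS eq_sym; case: eqP => _ /=; [rewrite IH | rewrite word_adj0].
Qed.

Lemma w_spike b m x : w (word (spike b m) x) = word (spike (~~ b) m) (w x).
Proof. by rewrite w_word /spike map_rcons map_nseq. Qed.

(** The monomial strips a prefix from each of the two copies of the spike, or
    kills it.  What remains is a pair of spikes with the same dominant letter
    if [w] is absent, orthogonal unless the stripped prefixes have the same
    length; if [w] is present, the dominant letters differ.  The scalar does
    not depend on [m], which lets linear combinations of monomials be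
    compressed by a common spike. *)
Lemma compress_monomial T : monomials T ->
  exists a N, forall m x, (N <= m)%N ->
    word_adj (spike false m) (T (word (spike false m) x)) = a *: x.
Proof.
case=> [mu [nu [e ->]]].
pose c := [&& ~~ e, all (pred1 false) mu, all (pred1 false) nu
            & size mu == size nu].
(* One more than the lengths, so that both remaining spikes keep a dominant
   letter. *)
exists c%:R, (maxn (size mu) (size nu)).+1 => m x.
rewrite gtn_max => /andP[mu_m nu_m].
rewrite /monomial spike_adj_word ?(ltnW mu_m)//.
rewrite (_ : (if e then _ else _) =
  word (spike e m) (if e then w x else x)); last first.
  by case: e {c} => //; rewrite w_spike.
rewrite word_adj_spike ?(ltnW nu_m)// {}/c.
case: (all (pred1 false) mu); last by rewrite andbF scale0r.
case: e => /=.
  rewrite scale0r; case: ifP => _; last by rewrite word_adj0.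
  by rewrite -(subnSK mu_m) -(subnSK nu_m) spike_flip_orthogonal.
case: ifP => _ /=; last by rewrite word_adj0 scale0r.
rewrite spike_orthogonal eqn_sub2lE ?(ltnW mu_m) ?(ltnW nu_m)//.
by case: eqP => _; rewrite ?scale1r ?scale0r.
Qed.

Lemma compress_span T : B T ->
  exists a N, forall m x, (N <= m)%N ->
    word_adj (spike false m) (T (word (spike false m) x)) = a *: x.
Proof.
elim=> [|a P Q /compress_monomial[b [N bN]] _ [c [N' cN']]].
  by exists 0, 0%N => m x _; rewrite word_adj0 scale0r.
exists (a * b + c), (maxn N N') => m x; rewrite geq_max => /andP[Nm N'm].
by rewrite word_adjP bN// cN'// scalerDl scalerA.
Qed.

End CuntzFlip.

(** * Inner products *)

Section Inner.
Context {R : realType} {H : hilbertType R}.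
Implicit Types (T P : H -> H) (x y : H) (c e : R[i]).

Lemma linear_image0 T : linear T -> T 0 = 0.
Proof.
by move=> linT; have := linT (-1) 0 0; rewrite scaleN1r addNr scaleN1r addNr.
Qed.

Lemma inner_conj x y : inner x y = (inner y x)^*.
Proof. by rewrite (hermC inner) /= mul1r. Qed.

Lemma inner_inj x y : (forall t, inner x t = inner y t) -> x = y.
Proof.
move=> xy; apply/eqP; rewrite -subr_eq0.
by rewrite -(dnorm_eq0 (inner : {dot H for Num.conj})) linearBl /= xy subrr.
Qed.

(** The Cauchy-Schwarz inequality, from the positivity of the norm of
    [|y|^2 x - <x, y> y]. *)
Lemma inner_le x y : `|inner x y| <= `|x| * `|y|.
Proof.
have [->|y0] := eqVneq y 0; first by rewrite linear0r normr0 mulr_ge0.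
have ny0 : 0 < `|y| by rewrite normr_gt0.
pose d := inner x y.
have := dnorm_ge0 (inner : {dot H for Num.conj}) (`|y| ^+ 2 *: x - d *: y).
rewrite dnormB !dnormZ linearZl_LR linearZr_LR /= !inner_normE -/d.
set m := `|y|; set n := `|x|.
rewrite [d^* * d]mulrC -normCK normrX normr_id -/m.
rewrite conj_Creal; last by rewrite realM ?realX ?normr_real.
move=> h.
have : 0 <= m ^+ 2 * ((n * m) ^+ 2 - `|d| ^+ 2).
  by apply: le_trans h _; rewrite le_eqVlt; apply/orP; left; apply/eqP; ring.
by rewrite /m /n pmulr_rge0 ?exprn_gt0// subr_ge0 ler_pXn2r ?nnegrE ?mulr_ge0.
Qed.

(** Polarization: the norms of [x + y] and [x + i y] determine the real and the
    imaginary part of [inner x y]. *)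
Lemma isometry_inner T : linear T -> (forall x, `|T x| = `|x|) ->
  forall x y, inner (T x) (T y) = inner x y.
Proof.
move=> linT isoT x y.
have polar v : inner (T x) (T v) + (inner (T x) (T v))^* =
               inner x v + (inner x v)^*.
  have TD : T (x + v) = T x + T v by rewrite -[x in LHS]scale1r linT scale1r.
  have := congr1 (fun t => t ^+ 2) (isoT (x + v)).
  rewrite -!inner_normE TD !dnormD !inner_normE !isoT.
  by move/addrI.
have T0 := linear_image0 linT.
have TZ : T ('i *: y) = 'i *: T y.
  by rewrite -[_ *: y in LHS]addr0 linT T0 addr0.
have p1 := polar y; have := polar ('i *: y).
rewrite TZ !linearZr_LR /= !rmorphM /= !conjCi !rmorphN /= !conjCi opprK.
set d := inner (T x) (T y) in p1 *; set d' := inner x y in p1 *.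
rewrite !mulNr => p2.
have p3 : d - d^* = d' - d'^*.
  apply: (mulfI (neq0Ci R[i])); apply: oppr_inj.
  by rewrite !mulrBr !opprB ![_ - 'i * _]addrC.
have : d *+ 2 = d' *+ 2.
  rewrite !mulr2n -[X in X + d](subrK d^*) -[X in _ = X + d'](subrK d'^*) p3.
  by rewrite -!addrA ![_^* + _]addrC p1.
by move/eqP; rewrite eqrMn2r // => /eqP.
Qed.

End Inner.

(** * Bounded operators, adjoints and norm closures *)

Section BoundedOperators.
Context {R : realType} {H : hilbertType R}.
Implicit Types (T P Q : H -> H) (x y : H) (c e : R[i]) (B : set (H -> H)).

(** Operator norm estimates are stated with complex bounds, like the norm of
    [H]; a positive complex number is real. *)
Definition bounded_by c T := forall x, `|T x| <= c * `|x|.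

Lemma bounded_operator_bound T :
  bounded_operator T -> exists2 c, 0 < c & bounded_by c T.
Proof.
case=> _ [M TM]; exists (`|M| + 1) => [|x]; first by rewrite ltr_wpDl.
apply: (@le_trans _ _ (`|M| * `|x|)); last by rewrite ler_wpM2r// lerDl.
have Mx0 : 0 <= M * `|x| by apply: le_trans (TM x).
by apply: le_trans (TM x) _; rewrite -(ger0_norm Mx0) normrM normr_id.
Qed.

Lemma bounded_byW c e T : c <= e -> bounded_by c T -> bounded_by e T.
Proof. by move=> ce Tc x; apply: le_trans (Tc x) _; rewrite ler_wpM2r. Qed.

Lemma bounded_byD c e T P :
  bounded_by c T -> bounded_by e P -> bounded_by (c + e) (T + P).
Proof.
by move=> Tc Pe x; apply: le_trans (ler_normD _ _) _; rewrite mulrDl lerD.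
Qed.

Lemma bounded_byZ a c T : bounded_by c T -> bounded_by (`|a| * c) (a *: T).
Proof. by move=> Tc x; rewrite /= normrZ -mulrA ler_wpM2l. Qed.

Lemma bounded_by_comp c e T P : 0 <= c ->
  bounded_by c T -> bounded_by e P -> bounded_by (c * e) (T \o P).
Proof.
move=> c0 Tc Pe x; apply: le_trans (Tc _) _.
by rewrite -mulrA ler_wpM2l.
Qed.

Lemma bounded_operator0 : bounded_operator (0 : H -> H).
Proof.
split=> [a x y|]; first by rewrite /= scaler0 addr0.
by exists 0 => x; rewrite normr0 mul0r.
Qed.

Lemma bounded_operatorD T P :
  bounded_operator T -> bounded_operator P -> bounded_operator (T + P).
Proof.
move=> [linT [c Tc]] [linP [e Pe]]; split; last first.
  by exists (c + e); apply: bounded_byD.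
by move=> a x y; rewrite /= !fctE linT linP scalerDr addrACA.
Qed.

Lemma bounded_operatorZ a T : bounded_operator T -> bounded_operator (a *: T).
Proof.
move=> [linT [c Tc]]; split; last first.
  by exists (`|a| * c); apply: bounded_byZ.
by move=> b x y; rewrite /= !fctE linT scalerDr !scalerA mulrC.
Qed.

Lemma bounded_operator_comp T P :
  bounded_operator T -> bounded_operator P -> bounded_operator (T \o P).
Proof.
move=> bT bP; have [linT _] := bT; have [linP _] := bP; split.
  by move=> a x y; rewrite /= linP linT.
have [c c0 Tc] := bounded_operator_bound bT.
have [e e0 Pe] := bounded_operator_bound bP.
by exists (c * e); apply: bounded_by_comp => //; apply: ltW.
Qed.

(** By homogeneity it suffices to look at unit vectors, whose images have norm
    at most the supremum that defines [opnorm]. *)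
Lemma opnorm_bound T (e : R) :
  bounded_operator T -> opnorm T < e -> bounded_by e%:C%C T.
Proof.
move=> bT Te x; have [linT _] := bT.
have [c c0 Tc] := bounded_operator_bound bT.
have [->|x0] := eqVneq x 0; first by rewrite linear_image0// !normr0 mulr0.
have nx0 : 0 < `|x| by rewrite normr_gt0.
pose y := `|x|^-1 *: x.
have ny : `|y| = 1 by rewrite normrZ normfV normr_id mulVf// gt_eqF.
have TyE : `|T y| = `|x|^-1 * `|T x|.
  by rewrite -[y]addr0 linT linear_image0// addr0 normrZ normfV normr_id.
suff Tye : `|T y| <= e%:C%C.
  by move: Tye; rewrite TyE mulrC ler_pdivrMr.
have leRe (a b : R[i]) : a <= b -> complex.Re a <= complex.Re b.
  by rewrite lecE => /andP[].
have : complex.Re `|T y| <= opnorm T.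
  apply: ub_le_sup; last by exists y => //=; rewrite ny.
  exists (complex.Re c) => _ [z /= z1 <-]; apply: leRe.
  by apply: le_trans (Tc z) _; rewrite ler_piMr// ltW.
move=> /le_lt_trans /(_ Te) /ltW; rewrite lecE /= => ->; rewrite andbT.
by have := normr_ge0 (T y); rewrite lecE /= => /andP[/eqP -> _].
Qed.

Lemma is_adjoint_sym T P : is_adjoint T P -> is_adjoint P T.
Proof. by move=> TP x y; rewrite inner_conj -TP -inner_conj. Qed.

Lemma is_adjoint_linear T P : is_adjoint T P -> linear P.
Proof.
move=> /is_adjoint_sym PT a x y; apply: inner_inj => t.
by rewrite PT linearDl linearZl_LR /= linearDl linearZl_LR /= !PT.
Qed.

(** From [|P x|^2 = <T (P x), x>] and Cauchy-Schwarz. *)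
Lemma is_adjoint_bounded_by c T P : 0 <= c ->
  is_adjoint T P -> bounded_by c T -> bounded_by c P.
Proof.
move=> c0 TP Tc x.
have [->|Px0] := eqVneq (P x) 0; first by rewrite normr0 mulr_ge0.
have nPx : 0 < `|P x| by rewrite normr_gt0.
rewrite -(ler_pM2l nPx) -expr2 -inner_normE -TP.
have := inner_le (T (P x)) x; rewrite TP inner_normE normrX normr_id => h.
by apply: le_trans h _; rewrite mulrA [_ * c]mulrC ler_wpM2r.
Qed.

Lemma adjointP T P : is_adjoint T P -> is_adjoint T (adjoint T).
Proof. by move=> TP; rewrite (adjointE TP). Qed.

Lemma adjoint_or0 T : is_adjoint T (adjoint T) \/ adjoint T = 0.
Proof.
case: (pselect (exists P, is_adjoint T P)) => [[P TP]|noadj].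
  by left; apply: adjointP TP.
by right; apply: xgetPN => P TP; apply: noadj; exists P.
Qed.

Definition norm_closure B : set (H -> H) :=
  [set T | bounded_operator T /\
    forall e, 0 < e -> exists2 P, B P & bounded_by e (T - P)].

Lemma sub_norm_closure B : B `<=` bounded_operator -> B `<=` norm_closure B.
Proof.
move=> Bb T BT; split=> [|e e0]; first exact: Bb.
by exists T => // x; rewrite subrr normr0 mulr_ge0// ltW.
Qed.

(** An operator [T] of the closure with no adjoint is harmless, since then
    [adjoint T] is 0; otherwise the adjoints of the operators which
    approximate [T] approximate [adjoint T] with the same error. *)
Lemma norm_closure_cstar B :
  B `<=` bounded_operator -> B 0 ->
  (forall T P, B T -> B P -> B (T + P)) ->
  (forall a T, B T -> B (a *: T)) ->
  (forall T P, B T -> B P -> B (T \o P)) ->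
  (forall T, B T -> exists2 P, B P & is_adjoint T P) ->
  cstar_subalgebra (norm_closure B).
Proof.
move=> Bb B0 BD BZ BM Badj; split.
- by move=> T [].
- exact: sub_norm_closure.
- move=> T P [bT aT] [bP aP]; split=> [|e e0]; first exact: bounded_operatorD.
  have e20 : 0 < e / 2 by rewrite divr_gt0.
  have [T' BT' TT'] := aT _ e20; have [P' BP' PP'] := aP _ e20.
  exists (T' + P'); first exact: BD.
  by rewrite opprD addrACA [e]splitr; apply: bounded_byD.
- move=> a T [bT aT]; split=> [|e e0]; first exact: bounded_operatorZ.
  have a0 : 0 < `|a| + 1 by rewrite ltr_wpDl.
  have [T' BT' TT'] := aT _ (divr_gt0 e0 a0).
  exists (a *: T'); first exact: BZ.
  rewrite -scalerBr; apply: bounded_byW (bounded_byZ a TT').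
  by rewrite mulrCA ler_piMr ?(ltW e0)// ler_pdivrMr// mul1r lerDl.
- move=> T P [bT aT] [bP aP].
  split=> [|e e0]; first exact: bounded_operator_comp.
  (* The bound on [T - T'] is chosen after [P'], since it depends on the size
     of [P']. *)
  have [c c0 Tc] := bounded_operator_bound bT.
  have e20 : 0 < e / 2 by rewrite divr_gt0.
  have [P' BP' PP'] := aP _ (divr_gt0 e20 c0).
  have [c' c'0 Pc'] := bounded_operator_bound (Bb _ BP').
  have [T' BT' TT'] := aT _ (divr_gt0 e20 c'0).
  exists (T' \o P'); first exact: BM.
  have -> : (T \o P) - (T' \o P') = (T \o (P - P')) + ((T - T') \o P').
    apply/funext => x; rewrite /= !fctE /= -[P x in LHS](subrK (P' x)).
    have [linT _] := bT; rewrite -[P x - P' x in LHS]scale1r linT scale1r.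
    by rewrite addrA.
  rewrite [e]splitr; apply: bounded_byD.
    rewrite -[e / 2](divfK (lt0r_neq0 c0)) mulrC.
    by apply: bounded_by_comp => //; apply: ltW.
  rewrite -[e / 2](divfK (lt0r_neq0 c'0)).
  by apply: bounded_by_comp => //; rewrite divr_ge0// ltW.
- move=> T [bT aT].
  case: (adjoint_or0 T) => [TA|->]; last exact: sub_norm_closure.
  have bA : bounded_operator (adjoint T).
    split; first exact: is_adjoint_linear TA.
    have [c c0 Tc] := bounded_operator_bound bT.
    by exists c; apply: is_adjoint_bounded_by Tc => //; apply: ltW.
  split=> // e e0; have [P BP TP] := aT e e0; have [P' BP' PP'] := Badj P BP.
  exists P' => //; apply: is_adjoint_bounded_by TP; first exact: ltW.
  move=> x y; rewrite !fctE linearBl /= linearBr /=.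
  by rewrite TA PP'.
- move=> T bT aT; split=> // e e0.
  have eE : e = (complex.Re e)%:C%C.
    have := ltW e0; rewrite lecE /= => /andP[/eqP Ie _].
    by rewrite [LHS]complexE Ie mulr0 addr0.
  have re0 : 0 < complex.Re e / 2.
    by move: e0; rewrite ltcE /= => /andP[_ ?]; rewrite divr_gt0.
  have [P [bP aP] TP] := aT _ re0.
  have e20 : 0 < e / 2 by rewrite divr_gt0.
  have [Q BQ PQ] := aP _ e20; exists Q => //.
  rewrite -[T](subrK P) -addrA [e]splitr; apply: bounded_byD => //.
  have -> : e / 2 = (complex.Re e / 2)%:C%C.
    by rewrite {1}eE rmorphM /= fmorphV rmorph_nat.
  apply: opnorm_bound TP; apply: bounded_operatorD => //.
  by rewrite -scaleN1r; apply: bounded_operatorZ.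
Qed.

(** The scalar is forced to be the Rayleigh quotient of [T] at any nonzero
    vector [t]; every approximating scalar is as close to it as to [T]. *)
Lemma almost_scalar T :
  (forall e, 0 < e -> exists a, forall x, `|T x - a *: x| <= e * `|x|) ->
  exists a, forall x, T x = a *: x.
Proof.
move=> aT; have [[t t0]|H0] := pselect (exists t : H, t != 0); last first.
  exists 0 => x; suff all0 y : y = 0 :> H by rewrite (all0 (T x)) scale0r.
  by apply/eqP; apply/negP => /negP y0; apply: H0; exists y.
have nt : 0 < `|t| ^+ 2 by rewrite exprn_gt0// normr_gt0.
exists (inner (T t) t / `|t| ^+ 2) => x; set b := inner _ _ / _.
apply/eqP; rewrite -subr_eq0 -normr_le0.
apply/ler_addgt0Pr => e e0; rewrite add0r.
have d0 : 0 < 2 * (`|x| + 1) by rewrite mulr_gt0// ltr_wpDl.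
have f0 := divr_gt0 e0 d0; have [a Ta] := aT _ f0; set f := e / _ in f0 Ta.
have ab : `|a - b| <= f.
  have bE : inner (T t) t = b * `|t| ^+ 2 by rewrite divfK// lt0r_neq0.
  have := inner_le (T t - a *: t) t.
  rewrite linearBl /= linearZl_LR /= inner_normE bE -mulrBl.
  rewrite normrM normrX normr_id distrC.
  move=> h; rewrite -(ler_pM2r nt); apply: le_trans h _.
  by rewrite expr2 mulrA ler_wpM2r.
rewrite -[T x](subrK (a *: x)) -addrA -scalerBl.
apply: le_trans (ler_normD _ _) _; rewrite normrZ.
apply: (@le_trans _ _ (f * `|x| + f * `|x|)); first by rewrite lerD// ler_wpM2r.
rewrite -mulr2n -mulrnAr -[`|x| *+ 2]mulr_natl /f mulrAC ler_pdivrMr//.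
by rewrite ler_wpM2l ?(ltW e0)// ler_wpM2l// lerDl.
Qed.

End BoundedOperators.

(** * Elements of the closure that commute with the isometries *)

Section FlipCommutant.
Context {R : realType} {H : hilbertType R}.
Variables (S Sa : bool -> {linear H -> H}) (w : {linear H -> H}).
Hypothesis SaS : forall i j x, Sa i (S j x) = if i == j then x else 0.
Hypothesis wS : forall i x, w (S i x) = S (~~ i) (w x).
Hypothesis wSa : forall i x, w (Sa i x) = Sa (~~ i) (w x).
Hypothesis ww : forall x, w (w x) = x.
Hypothesis S_adj : forall i, is_adjoint (S i) (Sa i).
Hypothesis w_adj : is_adjoint w w.
Hypothesis S_iso : forall i x, `|S i x| = `|x|.
Implicit Types (mu nu : seq bool) (x : H).

Let B := op_span (monomials S Sa w).

Lemma Sa_contraction i : bounded_by 1 (Sa i).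
Proof.
apply: is_adjoint_bounded_by (S_adj i) _ => // x.
by rewrite S_iso mul1r.
Qed.

Lemma word_isometry mu x : `|word S mu x| = `|x|.
Proof. by elim: mu => //= i mu IH; rewrite S_iso. Qed.

Lemma word_adj_contraction nu : bounded_by 1 (word_adj Sa nu).
Proof.
elim: nu => [|i nu IH] x /=; first by rewrite mul1r.
by apply: le_trans (IH _) _; rewrite mul1r; apply: Sa_contraction.
Qed.

Lemma w_isometry x : `|w x| = `|x|.
Proof.
by apply/eqP; rewrite -(eqrXn2 (n := 2))// -!inner_normE w_adj ww.
Qed.

Lemma word_is_adjoint mu : is_adjoint (word S mu) (word_adj Sa mu).
Proof. by elim: mu => //= i mu IH x y; rewrite S_adj IH. Qed.

Lemma span_bounded : B `<=` bounded_operator.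
Proof.
move=> T; elim=> [|a P Q [mu [nu [e ->]]] _ IH]; first exact: bounded_operator0.
apply: bounded_operatorD => //; apply: bounded_operatorZ; split.
  move=> c x y; rewrite /monomial.
  rewrite (_ : (if e then _ else _) =
    c *: (if e then w x else x) + (if e then w y else y)).
    by rewrite word_adjP wordP.
  by case: e; rewrite ?linearP.
exists 1 => x; rewrite word_isometry.
apply: le_trans (word_adj_contraction _ _) _.
by rewrite mul1r; case: e; rewrite ?w_isometry mul1r.
Qed.

Lemma span_adjoint T : B T -> exists2 P, B P & is_adjoint T P.
Proof.
elim=> [|a P Q [mu [nu [e ->]]] _ [Q' BQ' QQ']].
  by exists 0; [exact: op_span0 | move=> x y; rewrite linear0l linear0r].
(* [(S_mu S_nu^* w^e)^* = w^e S_nu S_mu^*]; the trailing identity is the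
   monomial on which the left multiplications act. *)
exists (a^* *: ((fun x => if e then w x else x) \o
                (word S nu \o (word_adj Sa mu \o idfun))) + Q').
  apply: op_spanD => //; apply: op_spanZ.
  exact/span_w_if/span_word/span_word_adj/span_id.
move=> x y; rewrite linearDl linearZl_LR linearDr /= linearZr_LR /= conjCK QQ'.
congr (_ * _ + _); rewrite /monomial word_is_adjoint.
rewrite (is_adjoint_sym (word_is_adjoint nu)).
by case: e; rewrite ?w_adj.
Qed.

Lemma closure_cstar : cstar_subalgebra (norm_closure B).
Proof.
apply: norm_closure_cstar.
- exact: span_bounded.
- exact: op_span0.
- exact: op_spanD.
- exact: op_spanZ.
- exact: span_comp.
- exact: span_adjoint.
Qed.

Lemma closure_S i : norm_closure B (S i).
Proof. exact/(sub_norm_closure span_bounded)/(span_S i (span_id S Sa w)). Qed.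

Lemma closure_w : norm_closure B w.
Proof.
exact/(sub_norm_closure span_bounded)/(span_w wS wSa ww (span_id S Sa w)).
Qed.

(** With [V] the isometry of a long spike, [z - a = V^* (z - P) V] where [a] is
    the compression of [P], so [z] is as close to a scalar as to the span. *)
Lemma closure_commutant z : norm_closure B z ->
  (forall i x, z (S i x) = S i (z x)) -> exists a, forall x, z x = a *: x.
Proof.
move=> [_ az] zS; apply: almost_scalar => e e0.
have [P BP zP] := az e e0; have [a [N aN]] := compress_span SaS wS BP.
pose V := spike false N; exists a => x.
have zV y : z (word S V y) = word S V (z y).
  by elim: V => //= i V IH; rewrite zS IH.
rewrite -(aN N)// -[z x](spike_isometry SaS false N) -zV.
have := word_adjP Sa (-1) V (P (word S V x)) (z (word S V x)).
rewrite !scaleN1r ![- _ + _]addrC => <-.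
apply: le_trans (word_adj_contraction _ _) _; rewrite mul1r.
by rewrite -(word_isometry V x); apply: zP.
Qed.

End FlipCommutant.

(** * The theorem *)

Theorem proposition2p3 (R : realType) (H : hilbertType R)
    (S1 S2 u w : H -> H)
    (S1_isometry : isometric_operator S1)
    (S2_isometry : isometric_operator S2)
    (sum_range : (S1 \o adjoint S1) + (S2 \o adjoint S2) = idfun)
    (u_unitary : unitary_operator u) (w_unitary : unitary_operator w)
    (subalgebra : cstar_generated [set S1; S2; u]
                    `<=` cstar_generated [set S1; S2; w])
    (u_square : u \o u = idfun) (w_square : w \o w = idfun)
    (u_flip : u \o S1 = S2 \o u) (w_flip : w \o S1 = S2 \o w) :
  u = w \/ u = - w.
Proof.
have [[t t0]|H0] := pselect (exists t : H, t != 0); last first.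
  left; apply/funext => x; have all0 y : y = 0 :> H.
    by apply/eqP/negP => /negP y0; apply: H0; exists y.
  by rewrite (all0 (u x)) (all0 (w x)).
have uu x : u (u x) = x by exact: (congr1 (@^~ x) u_square).
have ww x : w (w x) = x by exact: (congr1 (@^~ x) w_square).
have uS1 x : u (S1 x) = S2 (u x) by exact: (congr1 (@^~ x) u_flip).
have wS1 x : w (S1 x) = S2 (w x) by exact: (congr1 (@^~ x) w_flip).
have uS2 x : u (S2 x) = S1 (u x) by rewrite -{1}[x]uu -uS1 uu.
have wS2 x : w (S2 x) = S1 (w x) by rewrite -{1}[x]ww -wS1 ww.
have [[w_lin _] w'w _] := w_unitary.
have wE : adjoint w = w.
  apply/funext => x; rewrite -{1}[x]ww.
  exact: (congr1 (@^~ (w x)) w'w).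
(* The default value 0 of [adjoint w] is excluded by [w^* w = 1]. *)
have w_adj : is_adjoint w w.
  case: (adjoint_or0 w) => [|w0]; first by rewrite wE.
  by case/eqP: t0; rewrite -[t]ww -wE w0.
have flip_adj T P : is_adjoint T P -> is_adjoint (w \o T \o w) (w \o P \o w).
  by move=> TP x y; rewrite /= w_adj TP w_adj.
have S2E : S2 = w \o S1 \o w by apply/funext => x; rewrite /= wS1 ww.
have S1E : S1 = w \o S2 \o w by apply/funext => x; rewrite /= wS2 ww.
have S1_adj : is_adjoint S1 (adjoint S1).
  case: (adjoint_or0 S1) => // S1'0; case: (adjoint_or0 S2) => [S2_adj|S2'0].
    by apply: adjointP; rewrite {1}S1E; apply: flip_adj S2_adj.
  have : S1 0 + S2 0 = t by have := congr1 (@^~ t) sum_range; rewrite S1'0 S2'0.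
  have [[S1_lin _] _] := S1_isometry; have [[S2_lin _] _] := S2_isometry.
  rewrite (linear_image0 S1_lin) (linear_image0 S2_lin) addr0.
  by move=> /esym/eqP; rewrite (negPf t0).
have S2'E : adjoint S2 = w \o adjoint S1 \o w.
  by apply: adjointE; rewrite {1}S2E; apply: flip_adj.
have S2_adj : is_adjoint S2 (adjoint S2).
  by rewrite S2'E {1}S2E; apply: flip_adj.
have [[S1_lin _] S1_iso] := S1_isometry.
have [[S2_lin _] S2_iso] := S2_isometry.
have S1'S1 x : adjoint S1 (S1 x) = x.
  by apply: inner_inj => y; rewrite (is_adjoint_sym S1_adj) isometry_inner.
have S2'S2 x : adjoint S2 (S2 x) = x.
  by apply: inner_inj => y; rewrite (is_adjoint_sym S2_adj) isometry_inner.
have resolution x : S1 (adjoint S1 x) + S2 (adjoint S2 x) = x.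
  exact: (congr1 (@^~ x) sum_range).
have isometry_eq0 (T : H -> H) (y : H) :
  (forall x, `|T x| = `|x|) -> T y = 0 -> y = 0.
  by move=> isoT Ty; apply/eqP; rewrite -normr_eq0 -isoT Ty normr0.
(* Apply the resolution of the identity to a vector of the range of [S1]. *)
have S2'S1 x : adjoint S2 (S1 x) = 0.
  apply: (isometry_eq0 S2 _ S2_iso); apply: (addrI (S1 x)).
  by rewrite -{1}[x]S1'S1 resolution addr0.
have S1'S2 x : adjoint S1 (S2 x) = 0.
  apply: (isometry_eq0 S1 _ S1_iso); apply: (addIr (S2 x)).
  by rewrite -{2}[x]S2'S2 resolution add0r.
pose lin T (linT : linear T) : {linear H -> H} :=
  HB.pack T (GRing.isLinear.Build _ _ _ _ T linT).
pose S i := if i then lin S2 S2_lin else lin S1 S1_lin.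
pose Sa i := if i then lin _ (is_adjoint_linear S2_adj)
             else lin _ (is_adjoint_linear S1_adj).
pose W := lin w w_lin.
have SaS i j x : Sa i (S j x) = if i == j then x else 0.
  by case: i; case: j => /=.
have wS i x : W (S i x) = S (~~ i) (W x) by case: i => /=.
have wSa i x : W (Sa i x) = Sa (~~ i) (W x).
  by case: i; rewrite /= S2'E /= ww.
have S_adj i : is_adjoint (S i) (Sa i) by case: i.
have S_iso i x : `|S i x| = `|x| by case: i => /=.
have A_cstar := closure_cstar SaS wS wSa ww S_adj w_adj S_iso.
set A := norm_closure _ in A_cstar.
have A_S i : A (S i) by apply: closure_S.
have A_w : A w by apply: (@closure_w _ _ S Sa W).
(* [u] belongs to the smaller generated algebra, hence to the larger one. *)
have A_u : A u.
  suff : cstar_generated [set S1; S2; w] u.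
    apply; split=> // T [[->|->]|->] //.
      exact: (A_S false).
    exact: (A_S true).
  by apply: subalgebra => D [_]; apply; right.
have [a wu] : exists a, forall x, (w \o u) x = a *: x.
  apply: (closure_commutant SaS wS S_adj S_iso).
    exact: cstarM A_cstar _ _ A_w A_u.
  by case=> x /=; rewrite ?uS1 ?uS2 ?wS1 ?wS2.
have uE x : u x = a *: w x.
  have w0 := linear_image0 w_lin.
  by rewrite -[u x]ww [w (u x)]wu -[a *: x]addr0 w_lin w0 addr0.
have : a ^+ 2 == 1.
  rewrite -subr_eq0; have := uu t; rewrite !uE.
  have w0 := linear_image0 w_lin.
  rewrite -[a *: w t]addr0 w_lin w0 addr0 ww scalerA -expr2 => /eqP.
  by rewrite -subr_eq0 -{2}[t]scale1r -scalerBl scaler_eq0 (negPf t0) orbF.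
rewrite sqrf_eq1 => /orP[/eqP a1|/eqP a1]; [left|right]; apply/funext => x.
  by rewrite uE a1 scale1r.
by rewrite uE a1 scaleN1r.
Qed.
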